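(* There are constants $C, C_0>0$ such that the following holds. Let $p,q\le 0.75$ be parameters with $p>q$ such that $\max\{p(1-p),q(1-q)\}\ge C_0(\log n)/n$. Let $G$ be a random graph sampled from $\mathrm{SSBM}(n,k,p,q)$, and let $s^{*}$ be the size of the largest cluster. If $$s^{*}\ \ge\ C\cdot(\log n)^7\cdot\sqrt{p(1-q)}\cdot\sqrt{n}/(p-q),$$ then with probability $1-O(1/n)$ one of the clusters output by the Power Iteration Algorithm (run on $G$ with parameters $p,q$) is the largest cluster of $G$, for a suitable choice of the parameters $\Delta>0$ and $r>1$ of the algorithm.
   Context: $\mathrm{SSBM}(n,k,p,q)$ (symmetric stochastic block model): there is a vertex set $V=\{v_1,\dots,v_n\}$ with a hidden partition $V=\bigcup_{i=1}^k V_i$ into pairwise disjoint clusters. A random graph $G$ on $V$ is sampled by adding, for all pairs of vertices $v_i,v_j$, the edge $(v_i,v_j)$ independently with probability $p$ if $v_i,v_j$ lie in the same cluster and with probability $q$ otherwise. The pairs include $i=j$, so that the adjacency matrix $A$ is a random symmetric $0/1$ matrix whose entries on and above the diagonal are independent, and $\mathbb{E}[A_{i,j}]$ equals $p$ if $v_i,v_j$ are in the same cluster (including $i=j$) and $q$ otherwise. Power Iteration Algorithm. Input: the graph $G$ and $p,q>0$; it has parameters $\Delta>0$ and $r>1$. Let $A$ be the adjacency matrix of $G$ and $B:=A-q\cdot\mathbf{1}^{n\times n}$, where $\mathbf 1^{n\times n}$ is the all-ones matrix. Let $B^r_i$ denote the $i$-th row of the matrix power $B^r$. For all $v_i,v_j\in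 V$: if $\|B^r_i-B^r_j\|_2\le\Delta$, put $v_i$ and $v_j$ in the same cluster. Output the sets thus formed. The parameters $\Delta$ and $r$ may depend on $n,p,q,s^*$. The constant implied by $O(1/n)$ is absolute. *)

(* Defs.v *)
From HB Require Import structures.
From mathcomp Require Import all_boot all_order all_algebra.
From mathcomp Require Import reals exp.

Set Implicit Arguments.
Unset Strict Implicit.
Unset Printing Implicit Defensive.

Import Order.TTheory GRing.Theory Num.Theory.
Local Open Scope ring_scope.

(* The entries on and above the diagonal: one representative (i, j), i <= j,
   for each unordered pair of vertices; the pairs (i, i) are included. *)
Definition vpair (n : nat) := {e : 'I_n * 'I_n | (e.1 <= e.2)%N}.

(* An undirected graph, possibly with loops, given by its edge set. *)
Definition graph (n : nat) := {set vpair n}.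

Definition adjacent (n : nat) (G : graph n) (i j : 'I_n) : bool :=
  [exists e in G, (val e == (i, j)) || (val e == (j, i))].

Section SSBM.
Variables (R : realType) (n : nat).

(* The hidden partition is a partition P of [set: 'I_n] in the sense of finset,
   so that its clusters are the elements of P. *)
Definition edge_prob (P : {set {set 'I_n}}) (p q : R) (i j : 'I_n) : R :=
  if j \in pblock P i then p else q.

(* Probability mass function of the stochastic block model: each pair e is an
   edge independently with probability edge_prob. *)
Definition ssbm (P : {set {set 'I_n}}) (p q : R) (G : graph n) : R :=
  \prod_(e : vpair n)
    let pe := edge_prob P p q (val e).1 (val e).2 in
    if e \in G then pe else 1 - pe.

Definition ssbm_pr (P : {set {set 'I_n}}) (p q : R) (E : pred (graph n)) : R :=
  \sum_(G : graph n | E G) ssbm P p q G.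

Lemma ssbm_ge0 P p q G : 0 <= p <= 1 -> 0 <= q <= 1 -> 0 <= ssbm P p q G.
Proof.
move=> /andP[p0 p1] /andP[q0 q1]; apply: prodr_ge0 => e _ /=.
by rewrite /edge_prob; do 2!case: ifP => _ //; rewrite subr_ge0.
Qed.

Lemma ssbm_prT P p q : ssbm_pr P p q predT = 1.
Proof.
pose pe (e : vpair n) := edge_prob P p q (val e).1 (val e).2.
have <- : \prod_(e : vpair n) (pe e + (1 - pe e)) = 1.
  by apply: big1 => e _; rewrite subrKC.
by rewrite bigA_distr.
Qed.

End SSBM.

Section PowerIteration.
Variables (R : realType) (n : nat).

(* Euclidean norm; the library's norm on matrices is the sup norm. *)
Definition l2norm (x : 'rV[R]_n) : R := Num.sqrt (\sum_(j < n) x 0 j ^+ 2).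

Definition adj_mx (G : graph n) : 'M[R]_n :=
  \matrix_(i, j) (adjacent G i j)%:R.

Definition shifted_adj_mx (q : R) (G : graph n) : 'M[R]_n :=
  adj_mx G - q *: const_mx 1.

Definition close_rows (q Delta : R) (r : nat) (G : graph n) : rel 'I_n :=
  fun i j =>
    l2norm (row i (shifted_adj_mx q G ^+ r) - row j (shifted_adj_mx q G ^+ r))
      <= Delta.

(* close_rows need not be transitive: putting any two close vertices in the
   same cluster generates the classes of its transitive closure. The input p is
   only used through the choice of Delta and r. *)
Definition power_iteration (q Delta : R) (r : nat) (G : graph n)
    : {set {set 'I_n}} :=
  equivalence_partition (connect (close_rows q Delta r G)) [set: 'I_n].

End PowerIteration.

(* Main.v *)
Require Import Defs.
From HB Require Import structures.
From mathcomp Require Import all_boot all_order all_algebra.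
From mathcomp Require Import reals exp.
From mathcomp Require Import ring lra zify.

(** Write [B = M + N] with [M := (p - q) J] the expectation of [B], where [J] is
    the block matrix of the partition, and [N] the centered noise. Put
    [lam := (p - q) s], the norm of [M], and let [S] be a largest cluster.

    The rows of [M ^+ r] are constant on [S], and a row indexed by [S] is at
    distance at least [tau := lam ^+ r / sqrt s] from a row indexed outside [S].
    So it is enough to show that every row of [B ^+ r] is within [tau / 5] of the
    same row of [M ^+ r]: the threshold [Delta := tau / 2] then isolates [S] even
    after transitive closure ([power_iteration_recovers]).

    Cutting each word of [(M + N) ^+ r] at its first [M] gives
    [B ^+ r = \sum_(a < r) N ^+ a M B ^+ (r - 1 - a) + N ^+ r]
    ([mulmx_exprD]). Multiplying the trivial bound [|N| ^+ a |M|] out would lose a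
    factor [sqrt s] in every term, so the row-wise estimates
    [|e_x N ^+ a M| <= (lam / sqrt s) nu ^+ a] and [|e_x N ^+ r| <= nu ^+ r] are
    proved instead, with [nu] of order [r ^ 2 sqrt (n p)]. The hypothesis on [s]
    makes [lam / nu] at least [32 r], whence the terms sum to a small multiple of
    [tau] ([row_perturbation]). The exponent [r] is of order [log n], so that
    [(nu / lam) ^+ r] beats [1 / sqrt n] in the last term.

    Both row-wise estimates come from one moment computation
    ([expect_row_le]). The [m]-th power of [|e_x N ^+ a H| ^ 2] is a combination
    of products of noise entries along [2 m] walks of length [a] from [x], [L := 2
    m a] steps in all, with bounded coefficients when [H H^T] has bounded entries.
    As the noise is centered and independent, a product contributes only if every
    edge it uses is used twice; then it has [d <= L / 2] edges and, the walks being
    connected through [x], at most [d] vertices besides [x]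
    ([expect_weight_le]). A collection of walks visiting [k] such vertices
    contributes at most [n ^- k (n p) ^ (L / 2)], and summing [n ^- k] over all
    sequences of [L] vertices gives at most [(L + 2) ^ L]
    ([seq_sum_nb_new]). Taking [m = r] and Markov's inequality gives all the
    estimates outside an event of probability at most [1 / n]
    ([rows_concentrate]).

    The operator norm of [N] is read off from the same estimates: the rows of
    [N ^+ r] bound its Frobenius norm, and for [r] a power of two the bound
    descends to [N] by repeated square roots ([op_bound_sym]). *)

Set Implicit Arguments.
Unset Strict Implicit.
Unset Printing Implicit Defensive.

Import Order.TTheory GRing.Theory Num.Theory.
Local Open Scope ring_scope.

(** * Euclidean and operator norms *)

Section EuclideanNorm.
Variables (R : realType) (n : nat).
Implicit Types (u v : 'rV[R]_n) (A M N : 'M[R]_n).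

Lemma l2norm_ge0 u : 0 <= l2norm u.
Proof. exact: sqrtr_ge0. Qed.

Lemma sqr_l2norm u : l2norm u ^+ 2 = \sum_j u 0 j ^+ 2.
Proof. by rewrite sqr_sqrtr // sumr_ge0 // => j _; rewrite sqr_ge0. Qed.

Lemma l2norm_le u c : 0 <= c -> \sum_j u 0 j ^+ 2 <= c ^+ 2 -> l2norm u <= c.
Proof.
by move=> c0; rewrite -sqr_l2norm ler_pXn2r // ?nnegrE ?l2norm_ge0.
Qed.

Lemma cauchy_schwarz (I : finType) (a b : I -> R) :
  (\sum_i a i * b i) ^+ 2 <= (\sum_i a i ^+ 2) * (\sum_i b i ^+ 2).
Proof.
have : 0 <= \sum_i \sum_j (a i * b j - a j * b i) ^+ 2.
  by apply: sumr_ge0 => i _; apply: sumr_ge0 => j _; rewrite sqr_ge0.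
have -> : \sum_i \sum_j (a i * b j - a j * b i) ^+ 2 =
    (\sum_i a i ^+ 2) * (\sum_i b i ^+ 2)
    + (\sum_i b i ^+ 2) * (\sum_i a i ^+ 2)
    - 2 * ((\sum_i a i * b i) * (\sum_i a i * b i)).
  rewrite !big_distrlr /= mulr_sumr -big_split /= -sumrB.
  apply: eq_bigr => i _; rewrite mulr_sumr -big_split /= -sumrB.
  by apply: eq_bigr => j _; ring.
rewrite expr2; lra.
Qed.

Lemma l2normZ c u : l2norm (c *: u) = `|c| * l2norm u.
Proof.
rewrite /l2norm -sqrtr_sqr -sqrtrM ?sqr_ge0 // mulr_sumr.
by congr Num.sqrt; apply: eq_bigr => j _; rewrite mxE exprMn.
Qed.

Lemma l2norm0 : l2norm (0 : 'rV[R]_n) = 0.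
Proof. by rewrite -(scale0r (0 : 'rV[R]_n)) l2normZ normr0 mul0r. Qed.

Lemma l2normD u v : l2norm (u + v) <= l2norm u + l2norm v.
Proof.
apply: l2norm_le; first by rewrite addr_ge0 ?l2norm_ge0.
have uv : \sum_j u 0 j * v 0 j <= l2norm u * l2norm v.
  rewrite (le_trans (ler_norm _)) // -ler_sqr ?nnegrE ?mulr_ge0 ?l2norm_ge0 //.
  by rewrite real_normK ?num_real // exprMn !sqr_l2norm cauchy_schwarz.
rewrite sqrrD !sqr_l2norm.
under eq_bigr => j _ do rewrite mxE sqrrD -mulr_natl.
rewrite !big_split /= -mulr_sumr -mulr_natl; lra.
Qed.

Lemma l2norm_sum (I : Type) (s : seq I) (Q : pred I) (u : I -> 'rV[R]_n) :
  l2norm (\sum_(i <- s | Q i) u i) <= \sum_(i <- s | Q i) l2norm (u i).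
Proof.
elim/big_ind2 : _ => [|x1 x2 y1 y2 le1 le2|//].
  by rewrite l2norm0.
exact: le_trans (l2normD _ _) (lerD le1 le2).
Qed.

Lemma l2normN u : l2norm (- u) = l2norm u.
Proof. by rewrite -scaleN1r l2normZ normrN1 mul1r. Qed.

Lemma l2normB u v : l2norm (u - v) <= l2norm u + l2norm v.
Proof. by rewrite -(l2normN v) l2normD. Qed.

Definition op_bound A (c : R) := forall u, l2norm (u *m A) <= c * l2norm u.

Lemma op_boundX A c k : 0 <= c -> op_bound A c -> op_bound (A ^+ k) (c ^+ k).
Proof.
move=> c0 Ac; elim: k => [|k IHk] u; first by rewrite !expr0 mulmx1 mul1r.
rewrite exprSr mulmxA exprS -mulrA.
by rewrite (le_trans (Ac _)) // ler_wpM2l.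
Qed.

Lemma op_boundD A M a c :
  op_bound A a -> op_bound M c -> op_bound (A + M) (a + c).
Proof.
move=> Aa Mc u; rewrite mulmxDr mulrDl.
exact: le_trans (l2normD _ _) (lerD (Aa u) (Mc u)).
Qed.

Lemma sqr_l2norm_mulmx u A :
  l2norm (u *m A) ^+ 2 = \sum_x \sum_y u 0 x * (A *m A^T) x y * u 0 y.
Proof.
have -> : l2norm (u *m A) ^+ 2 = (u *m A *m (u *m A)^T) 0 0.
  rewrite sqr_l2norm [in RHS]mxE.
  by apply: eq_bigr => j _; rewrite [(_^T) _ _]mxE expr2.
rewrite trmx_mul mulmxA -(mulmxA u) mxE exchange_big.
by apply: eq_bigr => y _; rewrite mxE mulr_suml; apply: eq_bigr => x _;
  rewrite [u^T _ _]mxE.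
Qed.

(** For a symmetric [A], [|u A|^2 = <u A^2, u> <= |u A^2| |u|], so that squaring
    the matrix at most squares its operator norm; iterating transfers a crude
    bound on a high power back to [A], at the cost of a root of that order. *)
Lemma op_bound_sym A c k : A^T = A -> 0 <= c ->
  op_bound (A ^+ (2 ^ k)) (c ^+ (2 ^ k)) -> op_bound A c.
Proof.
elim: k A c => [|k IHk] A c symA c0; first by rewrite expn0 !expr1.
rewrite expnS !exprM => bnd.
have symA2 : (A ^+ 2)^T = A ^+ 2 by rewrite expr2 -mulmxE trmx_mul symA.
have {bnd}A2c := IHk _ _ symA2 (sqr_ge0 c) bnd => u.
rewrite -ler_sqr ?nnegrE ?mulr_ge0 ?l2norm_ge0 //.
apply: (@le_trans _ _ (l2norm (u *m A ^+ 2) * l2norm u)); last first.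
  rewrite exprMn [l2norm u ^+ 2]expr2 mulrA.
  by rewrite ler_wpM2r ?l2norm_ge0.
have -> : l2norm (u *m A) ^+ 2 = \sum_j (u *m A ^+ 2) 0 j * u 0 j.
  rewrite sqr_l2norm_mulmx symA exchange_big; apply: eq_bigr => y _.
  by rewrite mxE mulr_suml.
rewrite (le_trans (ler_norm _)) // -ler_sqr ?nnegrE ?mulr_ge0 ?l2norm_ge0 //.
by rewrite real_normK ?num_real // exprMn !sqr_l2norm cauchy_schwarz.
Qed.

Lemma op_bound_rows A c d : 0 <= c -> n%:R <= d ^+ 2 -> 0 <= d ->
  (forall i, l2norm (row i A) <= c) -> op_bound A (d * c).
Proof.
move=> c0 nd d0 Ac u; rewrite -ler_sqr ?nnegrE ?mulr_ge0 ?l2norm_ge0 //.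
apply: (@le_trans _ _ (l2norm u ^+ 2 * \sum_i l2norm (row i A) ^+ 2)).
  rewrite !sqr_l2norm.
  under [X in _ <= _ * X]eq_bigr => i _ do rewrite sqr_l2norm.
  rewrite exchange_big mulr_sumr; apply: ler_sum => j _.
  under [X in _ <= _ * X]eq_bigr => i _ do rewrite mxE.
  by rewrite mxE cauchy_schwarz.
rewrite exprMn mulrC ler_wpM2r ?sqr_ge0 //.
apply: (@le_trans _ _ (\sum_(i < n) c ^+ 2)).
  by apply: ler_sum => i _; rewrite ler_sqr ?nnegrE ?l2norm_ge0.
by rewrite sumr_const card_ord -mulr_natl exprMn ler_wpM2r ?sqr_ge0.
Qed.

End EuclideanNorm.

(** * Perturbation of the rows of a matrix power *)

Section Perturbation.
Variables (R : realType) (n : nat).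
Implicit Types (u : 'rV[R]_n) (M N : 'M[R]_n).

(** Each word in [M] and [N], read from the left, is cut at its first [M]. *)
Lemma mulmx_exprD M N u r :
  u *m (M + N) ^+ r =
    \sum_(a < r) u *m N ^+ a *m M *m (M + N) ^+ (r - a.+1) + u *m N ^+ r.
Proof.
elim: r u => [|r IHr] u; first by rewrite big_ord0 add0r !expr0.
rewrite exprS -mulmxE mulmxA mulmxDr mulmxDl (IHr (u *m N)).
rewrite big_ord_recl expr0 mulmx1 subSS subn0 -addrA; congr (_ + _).
rewrite exprS -mulmxE mulmxA; congr (_ + _).
by apply: eq_bigr => a _; rewrite !lift0 exprS -mulmxE !mulmxA subSS.
Qed.

Lemma l2norm_exprD_sub M N a c t u : 0 <= a -> 0 <= c ->
  op_bound M a -> op_bound N c ->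
  l2norm (u *m (M + N) ^+ t - u *m M ^+ t)
    <= ((a + c) ^+ t - a ^+ t) * l2norm u.
Proof.
move=> a0 c0 Ma Nc; have Bac := op_boundD Ma Nc.
elim: t u => [|t IHt] u.
  by rewrite !expr0 !subrr mul0r l2norm0.
have -> : u *m (M + N) ^+ t.+1 - u *m M ^+ t.+1 =
    u *m N *m (M + N) ^+ t
    + (u *m M *m (M + N) ^+ t - u *m M *m M ^+ t).
  by rewrite !exprS -!mulmxE !mulmxA mulmxDr mulmxDl [X in X - _]addrC addrA.
apply: le_trans (l2normD _ _) _.
have -> : (a + c) ^+ t.+1 - a ^+ t.+1 =
    (a + c) ^+ t * c + ((a + c) ^+ t - a ^+ t) * a by rewrite !exprS; ring.
rewrite mulrDl lerD //.
  rewrite (le_trans (op_boundX _ _ Bac _)) ?addr_ge0 // -mulrA ler_wpM2l //.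
  by rewrite exprn_ge0 // addr_ge0.
rewrite (le_trans (IHt _)) // -mulrA ler_wpM2l // subr_ge0.
by rewrite lerXn2r ?nnegrE ?addr_ge0 ?lerDl.
Qed.

(** Bernoulli's inequality in a form without division: [(1 + c / a) ^ t] is at
    most [1 / (1 - t c / a)] when [t c < a]. *)
Lemma exprD_le (a c : R) t : 0 <= a -> 0 <= c ->
  (a + c) ^+ t * (a - t%:R * c) <= a ^+ t.+1.
Proof.
move=> a0 c0; elim: t => [|t IHt]; first by rewrite mul0r subr0 mul1r expr1.
rewrite [in leRHS]exprS.
apply: le_trans (ler_wpM2l a0 IHt).
rewrite exprSr mulrCA -mulrA ler_wpM2l ?exprn_ge0 ?addr_ge0 // -subr_ge0.
have -> : a * (a - t%:R * c) - (a + c) * (a - t.+1%:R * c) = t.+1%:R * (c * c).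
  by rewrite -[t.+1]addn1 natrD; ring.
by rewrite !mulr_ge0.
Qed.

(** With [x := nu / lam <= 1 / (32 r)], the three groups of words are bounded by
    [tau := lam ^+ r / d] times [(1 + x) ^ r - 1] for those starting with [M],
    [r x (1 + x) ^ r] for those starting with [N] and containing an [M], and
    [d x ^ r <= 16 ^- r] for [N ^+ r]. *)
Lemma row_perturbation M N u (lam nu d : R) r :
  0 < lam -> 0 <= nu -> 0 < d -> (0 < r)%N ->
  32 * r%:R * nu <= lam -> d <= 2 ^+ r ->
  op_bound M lam -> op_bound N nu ->
  l2norm (u *m M) <= lam / d ->
  (forall a, (0 < a < r)%N -> l2norm (u *m N ^+ a *m M) <= lam / d * nu ^+ a) ->
  l2norm (u *m N ^+ r) <= nu ^+ r ->
  l2norm (u *m (M + N) ^+ r - u *m M ^+ r) <= lam ^+ r / d / 5.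
Proof.
case: r => // r lam0 nu0 d0 _ small dr Ml Nn uM uNM uN.
have Bn := op_boundD Ml Nn.
have ln0 : 0 <= lam + nu by rewrite addr_ge0 // ltW.
have growth : (lam + nu) ^+ r <= lam ^+ r * (32 / 31).
  have := exprD_le r (ltW lam0) nu0; rewrite exprSr => h.
  have {}h : (lam + nu) ^+ r * (31 / 32 * lam) <= lam ^+ r * lam.
    apply: le_trans h; rewrite ler_wpM2l ?exprn_ge0 //.
    have := small; rewrite -[r.+1]addn1 natrD; nra.
  have {}h : (lam + nu) ^+ r * (31 / 32) <= lam ^+ r.
    by rewrite -(ler_pM2r lam0) -mulrA.
  lra.
have ld0 : 0 <= lam / d by rewrite divr_ge0 // ltW.
rewrite mulmx_exprD big_ord_recl expr0 mulmx1 subSS subn0.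
rewrite [in u *m M ^+ _]exprS -mulmxE [u *m (M *m _)]mulmxA.
rewrite addrAC [X in l2norm (X + _)]addrAC.
have e1 : l2norm (u *m M *m (M + N) ^+ r - u *m M *m M ^+ r)
    <= lam ^+ r.+1 / d * (1 / 31).
  apply: le_trans (l2norm_exprD_sub r (u *m M) (ltW lam0) nu0 Ml Nn) _.
  have -> : lam ^+ r.+1 / d * (1 / 31) = lam ^+ r * (1 / 31) * (lam / d).
    by rewrite exprS; ring.
  apply: ler_pM; rewrite ?l2norm_ge0 // ?subr_ge0; last lra.
  by rewrite lerXn2r ?nnegrE ?lerDl // ltW.
have e2 : l2norm (\sum_(i < r) u *m N ^+ lift ord0 i *m M
      *m (M + N) ^+ (r.+1 - (lift ord0 i).+1)) <= lam ^+ r.+1 / d * (1 / 31).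
  apply: le_trans (l2norm_sum _ _ _) _.
  apply: (@le_trans _ _ (\sum_(i < r) lam / d * (nu * (lam + nu) ^+ r.-1))).
    apply: ler_sum => i _; rewrite lift0 subSS.
    apply: le_trans (op_boundX _ ln0 Bn _) _.
    have -> : r.-1 = (r - i.+1 + i)%N by have := ltn_ord i; lia.
    rewrite exprD; apply: le_trans (ler_wpM2l _ (uNM i.+1 _)) _;
      rewrite ?exprn_ge0 ?ltnS //=.
    rewrite mulrCA ler_wpM2l // exprS mulrCA ler_wpM2l // ler_wpM2l ?exprn_ge0 //.
    by rewrite lerXn2r ?nnegrE // lerDr ltW.
  rewrite sumr_const card_ord -[leLHS]mulr_natl.
  have -> : lam ^+ r.+1 / d * (1 / 31) = lam / d * (lam ^+ r * (1 / 31)).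
    by rewrite exprS; ring.
  rewrite mulrCA ler_wpM2l //.
  clear -lam0 nu0 ln0 small growth; case: r small growth => [|r] small growth.
    by rewrite mul0r expr0; lra.
  have h : r.+1%:R * nu <= 1 / 32 * (lam + nu).
    have : 0 <= nu := nu0; move: small; rewrite -[r.+2]addn1 natrD; lra.
  have := ler_wpM2r (exprn_ge0 r ln0) h; rewrite -!mulrA -exprS /=.
  move: growth; lra.
have e3 : l2norm (u *m N ^+ r.+1) <= lam ^+ r.+1 / d * (1 / 16).
  apply: le_trans uN _.
  have nl : nu <= lam / 32.
    have : 0 <= r%:R * nu by rewrite mulr_ge0.
    move: small; rewrite -[r.+1]addn1 natrD; lra.
  have : nu ^+ r.+1 <= (lam / 32) ^+ r.+1.
    by rewrite lerXn2r ?nnegrE // divr_ge0 // ltW.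
  move/le_trans; apply.
  rewrite expr_div_n -!mulrA ler_wpM2l ?exprn_ge0 ?(ltW lam0) //.
  rewrite mul1r -invfM lef_pV2 ?posrE ?mulr_gt0 ?exprn_gt0 //.
  have -> : (32 : R) = 2 * 16 by ring.
  rewrite exprMn; apply: ler_pM => //; first exact: ltW.
  by rewrite exprS ler_peMr // exprn_ege1 //; lra.
have h : 0 <= lam ^+ r.+1 / d by rewrite divr_ge0 ?exprn_ge0 // ltW.
apply: le_trans (l2normD _ _) _.
apply: le_trans (lerD (l2normD _ _) (lexx _)) _.
lra.
Qed.

End Perturbation.

(** * Recovery of a largest cluster from row estimates *)

Lemma class_of_separated (T : finType) (e : rel T) (S : {set T}) :
  S != set0 ->
  {in S &, forall x y, e x y} ->
  (forall x y, x \in S -> y \notin S -> ~~ e x y) ->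
  S \in equivalence_partition (connect e) [set: T].
Proof.
case/set0Pn => x Sx eS eSC; apply/imsetP; exists x => //.
apply/setP => y; rewrite !inE; apply/idP/idP => [Sy|].
  by apply: connect1; apply: eS.
case/connectP => t + ->; elim: t x Sx => //= z t IHt x Sx /andP[exz].
by apply: IHt; apply: contraT => /(eSC x z Sx) /negP.
Qed.

Section ClusterMatrix.
Variables (R : realType) (n : nat) (P : {set {set 'I_n}}) (s : nat).
Hypothesis partP : partition P [set: 'I_n].
Hypothesis le_s : forall X, X \in P -> (#|X| <= s)%N.

Definition cluster_mx : 'M[R]_n := \matrix_(x, y) (y \in pblock P x)%:R.

Lemma cover_partition x : x \in cover P.
Proof. by rewrite (cover_partition partP). Qed.

Lemma pblock_in x : pblock P x \in P.
Proof. exact: pblock_mem (cover_partition x). Qed.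

Lemma pblock_eqE x y : (y \in pblock P x) = (pblock P x == pblock P y).
Proof. by rewrite eq_pblock ?cover_partition ?(partition_trivIset partP). Qed.

Lemma pblock_sym x y : (y \in pblock P x) = (x \in pblock P y).
Proof. by rewrite !pblock_eqE eq_sym. Qed.

Lemma trmx_cluster : cluster_mx^T = cluster_mx.
Proof. by apply/matrixP => x y; rewrite !mxE pblock_sym. Qed.

Lemma sum_pblock x : \sum_y (y \in pblock P x)%:R = #|pblock P x|%:R :> R.
Proof.
by rewrite -sum1_card natr_sum [RHS]big_mkcond; apply: eq_bigr => y _; case: ifP.
Qed.

Lemma card_pblock_le x : #|pblock P x|%:R <= s%:R :> R.
Proof. by rewrite ler_nat le_s // pblock_in. Qed.

Lemma cluster_mx_sqr_le x y :
  `|(cluster_mx *m cluster_mx^T) x y| <= s%:R.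
Proof.
rewrite mxE ger0_norm; last first.
  by apply: sumr_ge0 => z _; rewrite !mxE mulr_ge0.
apply: le_trans (card_pblock_le x); rewrite -sum_pblock.
apply: ler_sum => z _; rewrite !mxE.
by case: (z \in _); case: (z \in _); rewrite ?mulr0 ?mul0r ?mulr1.
Qed.

Lemma op_bound_cluster : op_bound cluster_mx s%:R.
Proof.
move=> u; rewrite -ler_sqr ?nnegrE ?mulr_ge0 ?l2norm_ge0 //.
rewrite exprMn !sqr_l2norm.
apply: (@le_trans _ _
    (\sum_j \sum_x s%:R * (u 0 x ^+ 2 * (j \in pblock P x)%:R))).
  apply: ler_sum => j _; rewrite -mulr_sumr mxE.
  have -> : \sum_x u 0 x * cluster_mx x j =
      \sum_x (u 0 x * (j \in pblock P x)%:R) * (j \in pblock P x)%:R.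
    by apply: eq_bigr => x _; rewrite mxE; case: (j \in _) => /=; ring.
  apply: le_trans (cauchy_schwarz _ _) _; rewrite mulrC.
  have b2 (b : bool) : b%:R ^+ 2 = b%:R :> R by case: b; rewrite ?expr1n ?expr0n.
  apply: ler_pM.
  - by apply: sumr_ge0 => x _; rewrite sqr_ge0.
  - by apply: sumr_ge0 => x _; rewrite sqr_ge0.
  - apply: le_trans (card_pblock_le j); rewrite -sum_pblock.
    by apply: ler_sum => x _; rewrite b2 pblock_sym.
  - by apply: ler_sum => x _; rewrite exprMn b2.
rewrite exchange_big mulr_sumr; apply: ler_sum => x _.
rewrite -mulr_sumr -mulr_sumr sum_pblock [s%:R ^+ 2]expr2 -mulrA ler_wpM2l //.
by rewrite mulrC ler_wpM2r ?sqr_ge0 // card_pblock_le.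
Qed.

Lemma l2norm_row_cluster x : l2norm (row x cluster_mx) <= Num.sqrt s%:R.
Proof.
rewrite ler_wsqrtr // (le_trans _ (card_pblock_le x)) // -sum_pblock.
by apply: ler_sum => y _; rewrite !mxE; case: (y \in _); rewrite ?expr1n ?expr0n.
Qed.

Lemma trmx_exp (A : 'M[R]_n) k : A^T = A -> (A ^+ k)^T = A ^+ k.
Proof.
move=> symA; elim: k => [|k IHk]; first by rewrite expr0 trmx1.
by rewrite [in LHS]exprS -mulmxE trmx_mul symA IHk mulmxE -exprSr.
Qed.

Lemma cluster_mxX_row x y k : #|pblock P x| = s ->
  (cluster_mx ^+ k.+1) x y = s%:R ^+ k * (y \in pblock P x)%:R.
Proof.
move=> xs; elim: k y => [|k IHk] y; first by rewrite expr0 expr1 mul1r mxE.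
rewrite exprSr -mulmxE mxE; under eq_bigr => z _ do rewrite IHk mxE -mulrA.
rewrite -mulr_sumr exprSr -mulrA; congr (_ * _).
rewrite -xs -sum_pblock mulr_suml; apply: eq_bigr => z _.
case: (boolP (z \in pblock P x)) => [zx|]; rewrite ?mul0r ?mul1r //.
by rewrite (same_pblock (partition_trivIset partP) zx).
Qed.

Lemma cluster_mxX_row_eq x y k : #|pblock P x| = s -> y \in pblock P x ->
  row x (cluster_mx ^+ k.+1) = row y (cluster_mx ^+ k.+1).
Proof.
move=> xs yx; have eqB := same_pblock (partition_trivIset partP) yx.
by apply/rowP => z; rewrite !mxE !cluster_mxX_row ?eqB.
Qed.

(** The rows of a power of the cluster matrix at a vertex of a largest cluster
    and at one outside it differ at least by the full mass of the first row: by
    symmetry the second one vanishes on that cluster. *)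
Lemma cluster_mxX_row_sep x y k : #|pblock P x| = s -> y \notin pblock P x ->
  s%:R ^+ k * Num.sqrt s%:R
    <= l2norm (row x (cluster_mx ^+ k.+1) - row y (cluster_mx ^+ k.+1)).
Proof.
move=> xs yx.
rewrite -ler_sqr ?nnegrE ?mulr_ge0 ?exprn_ge0 ?sqrtr_ge0 ?l2norm_ge0 //.
rewrite exprMn sqr_sqrtr // sqr_l2norm -[in X in _ * X]xs -sum_pblock mulr_sumr.
apply: ler_sum => z _; case: (boolP (z \in _)) => [zx|_]; last first.
  by rewrite mulr0 sqr_ge0.
have eqB := same_pblock (partition_trivIset partP) zx.
have yz0 : (cluster_mx ^+ k.+1) y z = 0.
  rewrite -(trmx_exp _ trmx_cluster) mxE cluster_mxX_row ?eqB //.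
  by rewrite (negbTE yx) mulr0.
by rewrite !mxE yz0 cluster_mxX_row // zx subr0 !mulr1.
Qed.

Lemma expr_scalemx (d : R) (A : 'M[R]_n) k : (d *: A) ^+ k = d ^+ k *: A ^+ k.
Proof.
elim: k => [|k IHk]; first by rewrite !expr0 scale1r.
by rewrite !exprS IHk -!mulmxE -scalemxAl -scalemxAr scalerA.
Qed.

(** The unperturbed power separates the rows of a largest cluster from the other
    ones by [tau := (d s)^r / sqrt s]; perturbing each row by at most [tau / 5]
    keeps distances inside the cluster below [2 tau / 5] and the other ones
    above [3 tau / 5], on either side of the threshold [tau / 2]. *)
Lemma power_iteration_recovers (q d nu : R) (N : 'M[R]_n) (G : graph n) r S :
  (0 < s)%N -> 0 < d -> 0 <= nu -> (0 < r)%N ->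
  32 * r%:R * nu <= d * s%:R -> Num.sqrt s%:R <= 2 ^+ r :> R ->
  shifted_adj_mx q G = d *: cluster_mx + N ->
  op_bound N nu ->
  (forall x a, (0 < a < r)%N ->
    l2norm (row x (N ^+ a) *m cluster_mx) <= Num.sqrt s%:R * nu ^+ a) ->
  (forall x, l2norm (row x (N ^+ r)) <= nu ^+ r) ->
  S \in P -> #|S| = s ->
  S \in power_iteration q ((d * s%:R) ^+ r / Num.sqrt s%:R / 2) r G.
Proof.
case: r => // r s0 d0 nu0 _ small sr defB Nnu NJ Nr SP Ss.
have sR0 : 0 < s%:R :> R by rewrite ltr0n.
have q0 : 0 < Num.sqrt s%:R :> R by rewrite sqrtr_gt0.
have qq : Num.sqrt s%:R * Num.sqrt s%:R = s%:R :> R.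
  by rewrite -expr2 sqr_sqrtr // ltW.
have lq : d * s%:R / Num.sqrt s%:R = d * Num.sqrt s%:R :> R.
  by rewrite -mulrA -[X in _ * (X / _)]qq mulfK // gt_eqF.
set tau := (d * s%:R) ^+ r.+1 / Num.sqrt s%:R.
have tauE : tau = d ^+ r.+1 * (s%:R ^+ r * Num.sqrt s%:R).
  rewrite /tau exprMn [s%:R ^+ r.+1]exprSr -!mulrA -[X in _ * (_ * (X / _))]qq.
  by rewrite mulfK // gt_eqF.
have tau0 : 0 < tau by rewrite tauE !mulr_gt0 ?exprn_gt0.
have dM : op_bound (d *: cluster_mx) (d * s%:R).
  move=> u; rewrite -scalemxAr l2normZ gtr0_norm // -mulrA ler_wpM2l ?(ltW d0) //.
  exact: op_bound_cluster.
set B := shifted_adj_mx q G in defB *.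
have pert x : l2norm (row x (B ^+ r.+1) - row x ((d *: cluster_mx) ^+ r.+1))
    <= tau / 5.
  rewrite !(rowE x) defB; apply: (row_perturbation _ nu0) => //.
  - by rewrite mulr_gt0.
  - rewrite -rowE linearZ /= l2normZ gtr0_norm // lq ler_wpM2l ?(ltW d0) //.
    exact: l2norm_row_cluster.
  - move=> a ar; rewrite -rowE -scalemxAr l2normZ gtr0_norm // lq -mulrA.
    by rewrite ler_wpM2l ?(ltW d0) // NJ.
  - by rewrite -rowE.
have SE x : x \in S -> pblock P x = S.
  by move=> xS; rewrite (def_pblock (partition_trivIset partP) SP).
have split_rows (a b a' b' : 'rV[R]_n) : a - b = (a - a') + (a' - b') - (b - b').
  by rewrite opprB !subrKA.
apply: class_of_separated.
- by rewrite -card_gt0 Ss.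
- move=> x y Sx Sy; rewrite /close_rows -/B.
  rewrite (split_rows _ _ (row x ((d *: cluster_mx) ^+ r.+1))
    (row y ((d *: cluster_mx) ^+ r.+1))).
  have -> : row x ((d *: cluster_mx) ^+ r.+1) - row y ((d *: cluster_mx) ^+ r.+1)
      = 0.
    rewrite !expr_scalemx !linearZ /= (cluster_mxX_row_eq (y := y)) ?SE //.
    by rewrite scalerN subrr.
  rewrite addr0.
  have := l2normB (row x (B ^+ r.+1) - row x ((d *: cluster_mx) ^+ r.+1))
    (row y (B ^+ r.+1) - row y ((d *: cluster_mx) ^+ r.+1)).
  have := pert x; have := pert y; move: tau0; lra.
- move=> x y Sx NSy; rewrite /close_rows -/B -ltNge.
  have sep : tau <= l2norm (row x ((d *: cluster_mx) ^+ r.+1)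
      - row y ((d *: cluster_mx) ^+ r.+1)).
    rewrite !expr_scalemx !linearZ /= scalerN -scalerBr l2normZ tauE.
    rewrite gtr0_norm ?exprn_gt0 // ler_wpM2l ?exprn_ge0 ?(ltW d0) //.
    by apply: cluster_mxX_row_sep; rewrite SE.
  move: sep; rewrite (split_rows _ _ (row x (B ^+ r.+1)) (row y (B ^+ r.+1))).
  set u1 := _ - row x _; set u2 := _ - row y (B ^+ _); set u3 := _ - row y _.
  have := l2normB (u1 + u2) u3; have := l2normD u1 u2.
  have := pert x; have := pert y; rewrite -/u1 -/u2 -/u3.
  have : l2norm u1 = l2norm (row x (B ^+ r.+1) - row x ((d *: cluster_mx) ^+ r.+1)).
    by rewrite -l2normN opprB.
  have : l2norm u3 = l2norm (row y (B ^+ r.+1) - row y ((d *: cluster_mx) ^+ r.+1)).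
    by rewrite -l2normN opprB.
  move: tau0; lra.
Qed.

End ClusterMatrix.

(** * Sums over sequences of vertices *)

Section SequenceSums.
Variables (R : realType) (T : finType).
Implicit Types (f g : seq T -> R) (s h : seq T).

(** Recursion on the first entry, in place of a sum over tuples, makes both
    concatenation and the counting of repetitions inductive. *)
Fixpoint seq_sum L f : R :=
  if L is L'.+1 then \sum_x seq_sum L' (fun h => f (x :: h)) else f [::].

Lemma ler_seq_sum L f g :
  (forall h, size h = L -> f h <= g h) -> seq_sum L f <= seq_sum L g.
Proof.
elim: L f g => [|L IHL] f g fg /=; first exact: fg.
by apply: ler_sum => x _; apply: IHL => h hL; apply: fg; rewrite /= hL.
Qed.

Lemma eq_seq_sum L f g :
  (forall h, size h = L -> f h = g h) -> seq_sum L f = seq_sum L g.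
Proof.
by move=> fg; apply/eqP; rewrite eq_le !ler_seq_sum // => h /fg ->.
Qed.

Lemma seq_sumZ L c f : seq_sum L (fun h => c * f h) = c * seq_sum L f.
Proof.
elim: L f => [|L IHL] f //=; rewrite mulr_sumr.
by apply: eq_bigr => x _; rewrite IHL.
Qed.

Lemma seq_sum_norm L f : `|seq_sum L f| <= seq_sum L (fun h => `|f h|).
Proof.
elim: L f => [|L IHL] f //=; apply: le_trans (ler_norm_sum _ _ _) _.
by apply: ler_sum => x _.
Qed.

Lemma seq_sum_split L1 L2 (F : seq T -> seq T -> R) :
  seq_sum (L1 + L2) (fun h => F (take L1 h) (drop L1 h)) =
  seq_sum L1 (fun h1 => seq_sum L2 (fun h2 => F h1 h2)).
Proof.
elim: L1 F => [|L1 IH] F /=.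
  by rewrite add0n; apply: eq_seq_sum => h _; rewrite take0 drop0.
by apply: eq_bigr => x _; rewrite -(IH (fun h1 => F (x :: h1))).
Qed.

(** This is the number of distinct entries of [h] outside [s], in the order in
    which a walk discovers them. *)
Fixpoint nb_new s h : nat :=
  if h is x :: h' then ((x \notin s) + nb_new (x :: s) h')%N else 0%N.

(** An entry is either one of the fewer than [size s + L] values seen earlier, or
    one of [#|T|] new ones, whose total weight is [1]. *)
Lemma seq_sum_nb_new L s : (0 < #|T|)%N ->
  seq_sum L (fun h => #|T|%:R ^- nb_new s h) <= (size s + 1 + L)%:R ^+ L.
Proof.
move=> T0; have TR : 0 < #|T|%:R :> R by rewrite ltr0n.
elim: L s => [|L IHL] s /=; first by rewrite !expr0 invr1.
apply: (@le_trans _ _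
    (\sum_x #|T|%:R ^- (x \notin s) * (size s + 1 + L.+1)%:R ^+ L)).
  apply: ler_sum => x _.
  rewrite (eq_seq_sum (g := fun h => #|T|%:R ^- (x \notin s) *
      #|T|%:R ^- nb_new (x :: s) h)); last first.
    by move=> h _; rewrite exprD invfM.
  rewrite seq_sumZ ler_wpM2l ?invr_ge0 ?exprn_ge0 //.
  by apply: le_trans (IHL _) _; rewrite /= !addn1 !addSn addnS.
rewrite -mulr_suml exprS ler_wpM2r ?exprn_ge0 //.
apply: (@le_trans _ _ (\sum_x ((x \in s)%:R + #|T|%:R^-1))).
  apply: ler_sum => x _; case: (x \in s) => /=.
    by rewrite expr0 invr1 lerDl invr_ge0 ltW.
  by rewrite expr1 add0r.
rewrite big_split /= sumr_const -[X in _ + X]mulr_natl mulfV ?gt_eqF //.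
have le_card : \sum_(x : T) (x \in s)%:R <= (size s)%:R :> R.
  rewrite -natr_sum ler_nat; apply: leq_trans (card_size s).
  by rewrite -sum1_card [X in (_ <= X)%N]big_mkcond leq_sum // => x _; case: ifP.
by rewrite -[X in _ + X]/(1%:R) !natrD -addrA lerD // lerDl.
Qed.

End SequenceSums.

(** * Edges used by walks from a common root *)

Section Edges.
Variable n : nat.
Implicit Types (x y : 'I_n) (e : vpair n) (G : graph n).

(** The default value of [insubd] is never reached. *)
Definition edge_of x y : vpair n :=
  insubd (exist _ (x, x) (leqnn x) : vpair n)
    (if (x <= y)%N then (x, y) else (y, x)).

Lemma val_edge_of x y : val (edge_of x y) = if (x <= y)%N then (x, y) else (y, x).
Proof.
by rewrite val_insubd; case: (leqP x y) => [->|/ltnW ->].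
Qed.

Lemma edge_ofC x y : edge_of x y = edge_of y x.
Proof.
apply: val_inj; rewrite !val_edge_of.
by case: ltngtP => // /val_inj ->.
Qed.

Lemma adjacentE G x y : adjacent G x y = (edge_of x y \in G).
Proof.
apply/existsP/idP => [[e /andP[eG /orP exy]]|xyG]; last first.
  exists (edge_of x y); rewrite xyG val_edge_of.
  by case: ifP; rewrite eqxx ?orbT.
suff -> : edge_of x y = e by [].
apply: val_inj; rewrite val_edge_of; have := valP e.
case: exy => /eqP -> /=; first by move->.
move=> yx; case: ifP => // xy; rewrite (@val_inj _ _ _ x y) //.
by apply/eqP; rewrite eqn_leq xy.
Qed.

(** Every step starts at a vertex of [s] or at one reached by an earlier step;
    unlike paths, such lists of steps are stable under concatenation. *)
Fixpoint rooted (s : seq 'I_n) (es : seq ('I_n * 'I_n)) : bool :=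
  if es is (x, y) :: es' then (x \in s) && rooted (y :: s) es' else true.

Lemma rooted_sub s s' es : {subset s <= s'} -> rooted s es -> rooted s' es.
Proof.
elim: es s s' => // [[x y] es] IH s s' ss' /= /andP[/ss' -> /=].
by apply: IH => z; rewrite !inE => /orP[->//|/ss' ->]; rewrite orbT.
Qed.

Lemma rooted_cat s es1 es2 :
  rooted s es1 -> rooted s es2 -> rooted s (es1 ++ es2).
Proof.
elim: es1 s => // [[x y] es1] IH s /= /andP[-> r1] r2 /=.
by apply: IH r1 _; apply: rooted_sub r2 => z zs; rewrite inE zs orbT.
Qed.

Definition edges_outside (s : seq 'I_n) (es : seq ('I_n * 'I_n)) : {set vpair n} :=
  [set e in [seq edge_of d.1 d.2 | d <- es]
     | ~~ ((val e).1 \in s) || ~~ ((val e).2 \in s)].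

(** A connected graph has at least as many edges as non-root vertices: a vertex
    is discovered along an edge that no earlier step has used. *)
Lemma nb_new_le s es :
  rooted s es -> (nb_new s (map snd es) <= #|edges_outside s es|)%N.
Proof.
elim: es s => // [[x y] es] IH s /= /andP[xs /IH le_es].
have sub : edges_outside (y :: s) es \subset edges_outside s ((x, y) :: es).
  apply/subsetP => e; rewrite !inE /= => /andP[-> /=].
  by rewrite !negb_or; case/orP => /andP[_ ->]; rewrite !orbT.
case: (boolP (y \in s)) => ys /=.
  by rewrite add0n (leq_trans le_es) // subset_leq_card.
rewrite add1n.
have xyN : edge_of x y \notin edges_outside (y :: s) es.
  rewrite inE negb_and; apply/orP; right; rewrite negb_or !negbK val_edge_of.
  by case: ifP => _; rewrite /= !in_cons eqxx xs !orbT.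
have xyI : edge_of x y \in edges_outside s ((x, y) :: es).
  by rewrite !inE /= eqxx val_edge_of /=; case: ifP => _ /=; rewrite ys ?orbT.
apply: (@leq_trans #|edge_of x y |: edges_outside (y :: s) es|).
  by rewrite cardsU1 xyN.
by rewrite subset_leq_card // subUset sub1set xyI.
Qed.

Fixpoint steps x (h : seq 'I_n) : seq ('I_n * 'I_n) :=
  if h is y :: h' then (x, y) :: steps y h' else [::].

Lemma snd_steps x h : map snd (steps x h) = h.
Proof. by elim: h x => //= y h IH x; rewrite IH. Qed.

Lemma rooted_steps s x h : x \in s -> rooted s (steps x h).
Proof. by elim: h s x => //= y h IH s x ->; rewrite IH // mem_head. Qed.

End Edges.

(** * Moments of the rows of powers of the noise *)

Section Moments.
Variables (R : realType) (n : nat) (pe : vpair n -> R) (p : R).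
Hypothesis pe_ge0 : forall e, 0 <= pe e.
Hypothesis pe_le : forall e, pe e <= p.
Hypothesis p_le1 : p <= 1.
Implicit Types (e : vpair n) (G : graph n) (es : seq ('I_n * 'I_n)).

Definition random_graph G : R := \prod_e (if e \in G then pe e else 1 - pe e).

Definition expect (f : graph n -> R) : R := \sum_G random_graph G * f G.

Definition noise e G : R := (e \in G)%:R - pe e.

Definition noise_mx G : 'M[R]_n := \matrix_(x, y) noise (edge_of x y) G.

Definition weight G es : R := \prod_(d <- es) noise (edge_of d.1 d.2) G.

Lemma pe_le1 e : pe e <= 1. Proof. exact: le_trans (pe_le e) p_le1. Qed.

Lemma random_graph_ge0 G : 0 <= random_graph G.
Proof.
by apply: prodr_ge0 => e _; case: ifP => _ //; rewrite subr_ge0 pe_le1.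
Qed.

(** Grouping the factors by edge exposes the independence of distinct edges. *)
Lemma prod_count (I : finType) (F : I -> R) (s : seq I) :
  \prod_(i <- s) F i = \prod_i F i ^+ count_mem i s.
Proof.
elim: s => [|x s IH]; first by rewrite big_nil big1.
rewrite big_cons IH; under [RHS]eq_bigr => i _ do rewrite /= exprD.
rewrite big_split /=; congr (_ * _).
rewrite (bigD1 x) //= eqxx expr1 big1 ?mulr1 // => i /negbTE.
by rewrite eq_sym => ->.
Qed.

Definition noise_moment e c : R :=
  pe e * (1 - pe e) ^+ c + (1 - pe e) * (- pe e) ^+ c.

Lemma expect_weight es :
  expect (weight^~ es) =
    \prod_e noise_moment e (count_mem e [seq edge_of d.1 d.2 | d <- es]).
Proof.
rewrite bigA_distr /=; apply: eq_big => // G _.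
rewrite /weight -(big_map (fun d => edge_of d.1 d.2) predT (fun e => noise e G)).
rewrite prod_count /random_graph -big_split; apply: eq_bigr => e _ /=.
by rewrite /noise; case: (e \in G); rewrite ?sub0r.
Qed.

(** Centered and bounded by [1], the noise has all these moments bounded by its
    variance [pe e * (1 - pe e)]. *)
Lemma noise_moment_le e c : (1 < c)%N -> `|noise_moment e c| <= p.
Proof.
case: c => [|[|c]] // _; apply: le_trans (pe_le e).
have p0 := pe_ge0 e; have p1 := pe_le1 e; rewrite /noise_moment.
have q0 : 0 <= 1 - pe e by rewrite subr_ge0.
apply: le_trans (ler_normD _ _) _.
rewrite (normrM (pe e) ((1 - pe e) ^+ c.+2)).
rewrite (normrM (1 - pe e) ((- pe e) ^+ c.+2)) !normrX normrN !ger0_norm //.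
rewrite ![_ ^+ c.+2]exprS.
have h1 : (1 - pe e) ^+ c.+1 <= 1 - pe e.
  by rewrite exprS ler_piMr // exprn_ile1 // lerBlDr lerDl.
have h2 : pe e ^+ c.+1 <= pe e by rewrite exprS ler_piMr // exprn_ile1.
have := ler_wpM2l p0 (ler_wpM2l q0 h1); have := ler_wpM2l q0 (ler_wpM2l p0 h2).
have : 0 <= pe e * pe e by rewrite mulr_ge0.
nra.
Qed.

(** The expectation vanishes as soon as some edge is used exactly once, because
    the noise is centered. Otherwise the walk uses [d <= l] edges, each of which
    costs a factor [p], and the number [k] of vertices it discovers is at most
    [d]: the expectation is at most [p^d <= p^k = (n p)^k / n^k]. *)
Lemma expect_weight_le x l es : 1 <= n%:R * p ->
  rooted [:: x] es -> size es = l.*2 ->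
  `|expect (weight^~ es)|
     <= (n%:R * p) ^+ l * n%:R ^- nb_new [:: x] (map snd es).
Proof.
move=> np1 rt sz; rewrite expect_weight.
set c := fun e => count_mem e [seq edge_of d.1 d.2 | d <- es].
have n0 : 0 < n%:R :> R by rewrite ltr0n; apply: leq_ltn_trans (ltn_ord x).
have p0 : 0 < p by rewrite -(pmulr_rgt0 _ n0) (lt_le_trans ltr01).
have np0 : 0 <= n%:R * p by rewrite mulr_ge0 ?ltW.
case: (pickP (fun e => c e == 1%N)) => [e /eqP ce|c1].
  have m0 : noise_moment e 1 = 0 by rewrite /noise_moment; ring.
  by rewrite (bigD1 e) //= -/(c e) ce m0 mul0r normr0 mulr_ge0 ?invr_ge0 ?exprn_ge0 // ltW.
set D := [set e | c e != 0%N].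
have D2 : (#|D|.*2 <= l.*2)%N.
  rewrite -sz -(size_map (fun d => edge_of d.1 d.2)) -sum1_size.
  rewrite -muln2 -sum_nat_const.
  apply: (@leq_trans (\sum_e c e)).
    rewrite [X in (X <= _)%N]big_mkcond; apply: leq_sum => e _; rewrite inE.
    by case: eqP => //= ce0; have := c1 e; case: (c e) ce0 => [|[|]].
  rewrite /c; elim: [seq _ | _ <- _] => [|e0 t IH]; first by rewrite big_nil big1.
  rewrite big_cons /= big_split /= leq_add // (bigD1 e0) //= eqxx big1 // => e.
  by rewrite eq_sym => /negbTE ->.
have kD : (nb_new [:: x] (map snd es) <= #|D|)%N.
  apply: leq_trans (nb_new_le rt) _; apply: subset_leq_card.
  apply/subsetP => e; rewrite !inE => /andP[h _].
  by rewrite /c -lt0n -has_count has_pred1.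
set k := nb_new _ _ in kD *.
rewrite normr_prod.
apply: (@le_trans _ _ (p ^+ #|D|)).
  apply: (@le_trans _ _ (\prod_e (if e \in D then p else 1))).
    apply: ler_prod => e _; rewrite normr_ge0 /= inE -/(c e).
    have := c1 e; case: (c e) => [|[|m]] //= _; last exact: noise_moment_le.
    by rewrite /noise_moment !expr0 !mulr1 subrKC normr1.
  by rewrite -big_mkcond prodr_const.
apply: (@le_trans _ _ (p ^+ k)); first by rewrite ler_wiXn2l // ltW.
rewrite ler_pdivlMr ?exprn_gt0 // -exprMn mulrC ler_weXn2l //.
by apply: leq_trans kD _; rewrite -leq_double.
Qed.

(** These combinations of weights of rooted lists of [L] steps contain the
    quadratic forms in the rows of powers of the noise and are stable under
    products, so that one count bounds all their moments. Indexing by the [L]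
    vertices reached is enough: the starting points of the steps are determined
    by the shape of the walks. *)
Definition walk_sum x L (F : graph n -> R) :=
  exists (c : seq 'I_n -> R) (E : seq 'I_n -> seq ('I_n * 'I_n)),
    [/\ forall h, `|c h| <= 1,
        forall h, map snd (E h) = h /\ rooted [:: x] (E h) &
        forall G, F G = seq_sum L (fun h => c h * weight G (E h))].

Lemma weight_cat G es1 es2 : weight G (es1 ++ es2) = weight G es1 * weight G es2.
Proof. by rewrite /weight big_cat. Qed.

Lemma walk_sum1 x : walk_sum x 0 (fun=> 1).
Proof.
exists (fun=> 1), (steps x); split => [h|h|G]; first by rewrite normr1.
  by rewrite snd_steps rooted_steps ?mem_head.
by rewrite /= /weight big_nil mulr1.
Qed.

Lemma walk_sumM x L1 L2 F1 F2 : walk_sum x L1 F1 -> walk_sum x L2 F2 ->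
  walk_sum x (L1 + L2) (fun G => F1 G * F2 G).
Proof.
move=> [c1 [E1 [c1le E1P F1E]]] [c2 [E2 [c2le E2P F2E]]].
exists (fun h => c1 (take L1 h) * c2 (drop L1 h)).
exists (fun h => E1 (take L1 h) ++ E2 (drop L1 h)); split => [h|h|G].
- by rewrite normrM mulr_ile1.
- have [s1 r1] := E1P (take L1 h); have [s2 r2] := E2P (drop L1 h).
  by rewrite map_cat s1 s2 cat_take_drop rooted_cat.
rewrite F1E F2E.
rewrite (seq_sum_split _ _ (fun h1 h2 => c1 h1 * c2 h2 * weight G (E1 h1 ++ E2 h2))).
rewrite mulrC -seq_sumZ; apply: eq_seq_sum => h1 _.
rewrite mulrC -seq_sumZ; apply: eq_seq_sum => h2 _.
by rewrite weight_cat mulrACA.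
Qed.

Lemma walk_sumX x L F m : walk_sum x L F -> walk_sum x (m * L) (fun G => F G ^+ m).
Proof.
move=> FW; elim: m => [|m IHm].
  have [c [E [? ? FE]]] := walk_sum1 x.
  by exists c, E; split=> // G; rewrite expr0 FE.
have [c [E [? ? FE]]] := walk_sumM FW IHm.
by exists c, E; split=> // G; rewrite exprS mulSn FE.
Qed.

Lemma expect_seq_sum L (c : seq 'I_n -> R) (w : graph n -> seq 'I_n -> R) :
  expect (fun G => seq_sum L (fun h => c h * w G h)) =
  seq_sum L (fun h => c h * expect (w^~ h)).
Proof.
rewrite /expect; elim: L c w => [|L IHL] c w /=.
  by rewrite mulr_sumr; apply: eq_bigr => G _; rewrite mulrCA.
under eq_bigr do rewrite mulr_sumr.
rewrite exchange_big; apply: eq_bigr => y _ /=.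
by rewrite (IHL (fun h => c (y :: h)) (fun G h => w G (y :: h))).
Qed.

Lemma expect_walk_sum_le x l F : 1 <= n%:R * p -> walk_sum x l.*2 F ->
  expect F <= (l.*2 + 2)%:R ^+ l.*2 * (n%:R * p) ^+ l.
Proof.
move=> np1 [c [E [cle EP FE]]].
have -> : expect F = seq_sum l.*2 (fun h => c h * expect (weight^~ (E h))).
  by rewrite -expect_seq_sum; apply: eq_bigr => G _; rewrite FE.
apply: le_trans (ler_norm _) _; apply: le_trans (seq_sum_norm _ _) _.
have n0 : (0 < n)%N by apply: leq_ltn_trans (ltn_ord x).
have np0 : 0 <= (n%:R * p) ^+ l by rewrite exprn_ge0 // (le_trans ler01).
have := @seq_sum_nb_new R 'I_n l.*2 [:: x]; rewrite card_ord => /(_ n0).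
rewrite /= addnC => /(ler_wpM2r np0); apply: le_trans.
rewrite mulrC -seq_sumZ; apply: ler_seq_sum => h hL.
have [sndE rt] := EP h; rewrite normrM -[leRHS]mul1r.
have szE : size (E h) = l.*2 by rewrite -(size_map snd) sndE.
by have := expect_weight_le np1 rt szE; rewrite sndE; apply: ler_pM.
Qed.

Lemma noise_mxX_sum G a x (f : 'I_n -> R) :
  \sum_y (noise_mx G ^+ a) x y * f y =
  seq_sum a (fun h => weight G (steps x h) * f (last x h)).
Proof.
elim: a x => [|a IHa] x /=.
  rewrite expr0 (bigD1 x) //= big1 ?addr0 => [|y /negbTE yx].
    by rewrite mxE eqxx /weight big_nil.
  by rewrite mxE eq_sym yx mul0r.
under eq_bigr => y _ do rewrite exprS -mulmxE mxE mulr_suml.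
rewrite exchange_big; apply: eq_bigr => z _ /=.
under eq_bigr => y _ do rewrite -mulrA.
rewrite -mulr_sumr IHa -seq_sumZ; apply: eq_seq_sum => h _.
by rewrite /weight big_cons mxE mulrA.
Qed.

(** The squared norm is the quadratic form of [H H^T] at two copies of the row,
    hence a sum over pairs of walks from [x] with coefficients entries of
    [H H^T]. *)
Lemma walk_sum_row x a (H : 'M[R]_n) :
  (forall y z, `|(H *m H^T) y z| <= 1) ->
  walk_sum x a.*2 (fun G => l2norm (row x (noise_mx G ^+ a) *m H) ^+ 2).
Proof.
move=> H1.
exists (fun h => (H *m H^T) (last x (take a h)) (last x (drop a h))).
exists (fun h => steps x (take a h) ++ steps x (drop a h)); split => [h|h|G] //.
  by rewrite map_cat !snd_steps cat_take_drop rooted_cat ?rooted_steps ?mem_head.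
rewrite -addnn (seq_sum_split _ _ (fun h1 h2 => (H *m H^T) (last x h1) (last x h2)
  * weight G (steps x h1 ++ steps x h2))).
rewrite sqr_l2norm_mulmx.
under eq_bigr => y _ do under eq_bigr => z _ do rewrite !(mxE _ _ 0) -mulrA.
under eq_bigr => y _ do rewrite -mulr_sumr.
rewrite noise_mxX_sum; apply: eq_seq_sum => h1 _.
under eq_bigr => z _ do rewrite mulrC.
rewrite noise_mxX_sum -seq_sumZ; apply: eq_seq_sum => h2 _.
by rewrite weight_cat; ring.
Qed.

Lemma expect_row_le x a m (H : 'M[R]_n) : 1 <= n%:R * p ->
  (forall y z, `|(H *m H^T) y z| <= 1) ->
  expect (fun G => (l2norm (row x (noise_mx G ^+ a) *m H) ^+ 2) ^+ m)
    <= (((m * a).*2 + 2)%:R ^+ 2 * (n%:R * p)) ^+ (m * a).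
Proof.
move=> np1 H1; rewrite exprMn -exprM mul2n.
by apply: expect_walk_sum_le np1 _; rewrite doubleMr; apply/walk_sumX/walk_sum_row.
Qed.

End Moments.

(** * Concentration of all the rows *)

Section Concentration.
Variables (R : realType) (n : nat) (pe : vpair n -> R) (p : R).
Hypothesis pe_ge0 : forall e, 0 <= pe e.
Hypothesis pe_le : forall e, pe e <= p.
Hypothesis p_le1 : p <= 1.
Implicit Types (G : graph n).

Lemma sum_random_graph : \sum_G random_graph pe G = 1.
Proof.
transitivity (\prod_e (pe e + (1 - pe e))); first by rewrite bigA_distr.
by apply: big1 => e _; rewrite subrKC.
Qed.

Lemma markov_random_graph (Q : pred (graph n)) (Y : graph n -> R) :
  (forall G, 0 <= Y G) -> (forall G, Y G < 1 -> Q G) ->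
  1 - expect pe Y <= \sum_(G | Q G) random_graph pe G.
Proof.
move=> Y0 YQ; rewrite -sum_random_graph (bigID Q) /= -addrA gerDl subr_le0.
have pmf0 G := random_graph_ge0 pe_ge0 pe_le p_le1 G.
rewrite big_mkcond; apply: ler_sum => G _; case: ifP => [NQ|_].
  by rewrite ler_peMr // leNgt; apply: contra NQ => /YQ.
by rewrite mulr_ge0.
Qed.

Lemma expect_sum (I : Type) (s : seq I) (f : I -> graph n -> R) :
  expect pe (fun G => \sum_(i <- s) f i G) = \sum_(i <- s) expect pe (f i).
Proof.
rewrite /expect exchange_big; apply: eq_bigr => G _ /=.
by rewrite mulr_sumr.
Qed.

Lemma expectZ c f : expect pe (fun G => f G * c) = expect pe f * c.
Proof. by rewrite /expect mulr_suml; apply: eq_bigr => G _; rewrite mulrA. Qed.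

(** One application of Markov's inequality to the sum of the normalized moments
    of order [2 r] over all vertices, powers and matrices controls all the rows
    at once; each moment is at most [16 ^- r], which beats their number. *)
Lemma rows_concentrate (I : finType) (H : I -> 'M[R]_n) r (nu : R)
    (Q : pred (graph n)) :
  (0 < r)%N -> (0 < n <= 2 ^ r)%N -> (#|I| <= 2)%N -> 1 <= n%:R * p ->
  (forall i y z, `|(H i *m (H i)^T) y z| <= 1) ->
  0 < nu -> nu ^+ 2 = 16 * ((2 * r ^ 2 + 2)%:R ^+ 2 * (n%:R * p)) ->
  (forall G, (forall x a i, (0 < a <= r)%N ->
      l2norm (row x (noise_mx pe G ^+ a) *m H i) <= nu ^+ a) -> Q G) ->
  1 - 1 / n%:R <= \sum_(G | Q G) random_graph pe G.
Proof.
move=> r0 /andP[n0 nr] I2 np1 H1 nu0 nuE HQ.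
pose Z x a i G := (l2norm (row x (noise_mx pe G ^+ a) *m H i) ^+ 2) ^+ r.
pose Y G := \sum_x \sum_(a < r) \sum_i Z x a.+1 i G * (nu ^+ 2) ^- (r * a.+1).
have nu2 : 0 < nu ^+ 2 by rewrite exprn_gt0.
have Zg x a i G : 0 <= Z x a i G * (nu ^+ 2) ^- (r * a).
  by apply: mulr_ge0; rewrite ?invr_ge0 /Z exprn_ge0 ?sqr_ge0.
have np0 : 0 <= n%:R * p by apply: le_trans np1.
have nR : 0 < n%:R :> R by rewrite ltr0n.
apply: le_trans (@markov_random_graph Q Y _ _); first last.
- move=> G YG; apply: HQ => x a i /andP[a0 ar].
  rewrite leNgt; apply/negP => big.
  move: YG; rewrite ltNge => /negP; apply.
  case: a a0 ar big => // a _ ar big.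
  rewrite /Y (bigD1 x) //= (bigD1 (Ordinal ar)) //= (bigD1 i) //=.
  rewrite -!addrA ler_wpDr //.
    by rewrite !addr_ge0 //; do ?[apply: sumr_ge0 => ? _].
  rewrite ler_pdivlMr ?exprn_gt0 // mul1r /Z mulnC exprM.
  rewrite lerXn2r ?nnegrE ?exprn_ge0 ?sqr_ge0 ?l2norm_ge0 ?(ltW nu0) //.
  rewrite -exprM mulnC exprM.
  by rewrite lerXn2r ?nnegrE ?exprn_ge0 ?l2norm_ge0 ?(ltW nu0) ?(ltW big).
- by move=> G; rewrite /Y; do 3![apply: sumr_ge0 => ? _].
rewrite lerD2l lerN2.
have term x (a : 'I_r) i :
    expect pe (fun G => Z x a.+1 i G * (nu ^+ 2) ^- (r * a.+1)) <= 16 ^- r.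
  rewrite expectZ ler_pdivrMr ?exprn_gt0 //.
  apply: le_trans (expect_row_le pe_ge0 pe_le p_le1 _ _ _ np1 (H1 i)) _.
  apply: (@le_trans _ _ (((2 * r ^ 2 + 2)%:R ^+ 2 * (n%:R * p)) ^+ (r * a.+1))).
    rewrite lerXn2r ?nnegrE ?(mulr_ge0 _ np0) ?sqr_ge0 // ler_wpM2r //.
    rewrite lerXn2r ?nnegrE // ler_nat leq_add2r -mul2n leq_mul2l /=.
    by rewrite -mulnn leq_mul2l ltn_ord orbT.
  rewrite nuE [X in _ <= _ * X]exprMn [leRHS]mulrA -[leLHS]mul1r ler_wpM2r //.
    by rewrite exprn_ge0 // mulr_ge0 ?sqr_ge0.
  rewrite mulrC ler_pdivlMr ?exprn_gt0 // mul1r ler_weXn2l ?leq_pmulr //.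
  by rewrite ler1n.
apply: (@le_trans _ _ (\sum_(x < n) \sum_(a < r) \sum_(i : I) 16 ^- r)).
  rewrite /Y expect_sum; apply: ler_sum => x _.
  rewrite expect_sum; apply: ler_sum => a _.
  by rewrite expect_sum; apply: ler_sum => i _; apply: term.
rewrite !sumr_const !card_ord -!mulrnA -[leLHS]mulr_natr.
rewrite [leLHS]mulrC ler_pdivrMr ?exprn_gt0 // mul1r ler_pdivlMl //.
rewrite -natrM -natrX ler_nat.
have r2 : (r * 2 <= 2 ^ r)%N.
  case: r r0 {nr nuE HQ Z Y Zg term} => // r _.
  by rewrite expnSr leq_mul2r /= ltn_expl.
rewrite (_ : 16 = 2 * (2 * (2 * 2)))%N // !expnMn.
have cI : (#|(xpredT : pred I)| <= 2)%N.
  by apply: leq_trans I2; apply: subset_leq_card; apply/subsetP.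
move: cI r2 nr; set c := #|_|; set X := (2 ^ r)%N => c2 r2 nX.
have cr : (c * r <= X)%N by apply: leq_trans r2; rewrite mulnC leq_mul2l c2 orbT.
rewrite [(c * _)%N]mulnA [(X * (X * X))%N]mulnA.
apply: leq_mul => //; apply: leq_mul => //; apply: leq_trans cr _.
by rewrite leq_pmulr // expn_gt0.
Qed.

End Concentration.

(** * The stochastic block model *)

Section Model.
Variables (R : realType) (n : nat) (P : {set {set 'I_n}}) (p q : R).
Hypothesis partP : partition P [set: 'I_n].

Definition pair_prob (e : vpair n) : R := edge_prob P p q (val e).1 (val e).2.

Lemma pair_prob_edge x y : pair_prob (edge_of x y) = edge_prob P p q x y.
Proof.
rewrite /pair_prob val_edge_of; case: ifP => _ //=.
by rewrite /edge_prob (pblock_sym partP).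
Qed.

Lemma ssbm_prE (Q : pred (graph n)) :
  ssbm_pr P p q Q = \sum_(G | Q G) random_graph pair_prob G.
Proof. by []. Qed.

Lemma shifted_adj_mxE G : shifted_adj_mx q G =
  (p - q) *: cluster_mx R P + noise_mx pair_prob G.
Proof.
apply/matrixP => x y; rewrite !mxE adjacentE /noise pair_prob_edge /edge_prob.
by case: (y \in _) => /=; ring.
Qed.

Lemma trmx_noise (pe : vpair n -> R) G : (noise_mx pe G)^T = noise_mx pe G.
Proof. by apply/matrixP => x y; rewrite !mxE edge_ofC. Qed.

(** The constant [1024 r ^ 3] is the product of the ratio [32 r] that the
    perturbation bound requires and of [32 r ^ 2], which bounds the factor of
    [sqrt (n p)] in the noise level [8 (2 r ^ 2 + 2) sqrt (n p)]. *)
Lemma power_iteration_whp k s :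
  let r := (2 ^ k)%N in
  0 < q -> q < p -> p <= 1 -> 1 <= n%:R * p -> (0 < s)%N -> (n <= 2 ^ r)%N ->
  1024 * r%:R ^+ 3 * Num.sqrt (n%:R * p) <= (p - q) * s%:R ->
  (forall X, X \in P -> (#|X| <= s)%N) ->
  forall S, S \in P -> #|S| = s ->
  1 - 1 / n%:R <= ssbm_pr P p q (fun G =>
    S \in power_iteration q (((p - q) * s%:R) ^+ r / Num.sqrt s%:R / 2) r G).
Proof.
move=> r q0 qp p1 np1 s0 nr small le_s S SP Ss.
have r0 : (0 < r)%N by rewrite expn_gt0.
have sR0 : 0 < s%:R :> R by rewrite ltr0n.
have sn : (s <= n)%N by rewrite -Ss -[n in (_ <= n)%N]card_ord max_card.
have n0 : (0 < n)%N by apply: leq_trans sn.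
pose root := Num.sqrt (n%:R * p).
(* The factor 4 is the square root of the base 16 in [rows_concentrate]. *)
pose nu : R := 4 * (2 * r ^ 2 + 2)%:R * root.
have root0 : 0 < root by rewrite sqrtr_gt0 (lt_le_trans ltr01).
have nu0 : 0 < nu by rewrite !mulr_gt0 // ltr0n addn2.
have sq0 : 0 < Num.sqrt s%:R :> R by rewrite sqrtr_gt0.
(* The two matrices whose rows are controlled together: the block matrix, scaled
   so that [H H^T] has entries at most 1, and the identity, for [N ^+ r]. *)
pose H (b : bool) : 'M[R]_n :=
  if b then (Num.sqrt s%:R)^-1 *: cluster_mx R P else 1%:M.
rewrite ssbm_prE; apply: (@rows_concentrate R n pair_prob p _ _ p1 _ H r nu _ r0) => //.
- by move=> e; rewrite /pair_prob /edge_prob; case: ifP => _; lra.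
- by move=> e; rewrite /pair_prob /edge_prob; case: ifP => _; lra.
- by rewrite n0.
- by rewrite card_bool.
- case=> y z; rewrite /H; last first.
    by rewrite trmx1 mulmx1 mxE; case: eqP => _; rewrite ?normr1 ?normr0.
  rewrite linearZ /= -scalemxAl -scalemxAr scalerA -invfM -expr2 sqr_sqrtr ?(ltW sR0) //.
  rewrite mxE normrM gtr0_norm ?invr_gt0 // ler_pdivrMl // mulr1.
  exact: cluster_mx_sqr_le.
- by rewrite /nu /root !exprMn sqr_sqrtr; [ring|apply: le_trans np1].
move=> G good.
have N1 x a : (0 < a <= r)%N -> l2norm (row x (noise_mx pair_prob G ^+ a)) <= nu ^+ a.
  by move=> a_r; have := good x a false a_r; rewrite /H mulmx1.
have nun2 : 0 <= 2 * nu by rewrite pmulr_rge0 // ltW.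
(* The factor 2 pays for [sqrt n <= 2 ^ r], the price of the Frobenius norm. *)
have nu2 : op_bound (noise_mx pair_prob G) (2 * nu).
  apply: (op_bound_sym (k := k)) => //; first exact: trmx_noise.
  rewrite exprMn; apply: op_bound_rows; rewrite ?exprn_ge0 ?(ltW nu0) //.
    rewrite -exprM -natrX ler_nat; apply: leq_trans nr _.
    by rewrite leq_exp2l // muln2 -addnn leq_addr.
  by move=> x; apply: N1; rewrite r0 /=.
have nuX a : nu ^+ a <= (2 * nu) ^+ a.
  by rewrite lerXn2r ?nnegrE ?(ltW nu0) // ler_peMl ?(ltW nu0) // ler1n.
apply: (power_iteration_recovers partP le_s (nu := 2 * nu)
  (N := noise_mx pair_prob G)) => //.
- by rewrite subr_gt0.
- apply: le_trans small; rewrite /nu -/root.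
  have -> : 32 * r%:R * (2 * (4 * (2 * r ^ 2 + 2)%:R * root)) =
     (256 * r%:R * (2 * r ^ 2 + 2)%:R) * root :> R by ring.
  rewrite ler_wpM2r ?(ltW root0) //.
  rewrite -natrX -!natrM ler_nat; nia.
- rewrite -(ger0_norm (exprn_ge0 r (ler0n R 2))) -sqrtr_sqr ler_wsqrtr //.
  rewrite -exprM -natrX ler_nat (leq_trans sn) // (leq_trans nr) //.
  by rewrite leq_exp2l // leq_pmulr.
- exact: shifted_adj_mxE.
- move=> x a /andP[a0 /ltnW ar].
  have : l2norm (row x (noise_mx pair_prob G ^+ a) *m H true) <= nu ^+ a.
    by apply: good; rewrite a0.
  rewrite /H -scalemxAr l2normZ gtr0_norm ?invr_gt0 // ler_pdivrMl // => h.
  by apply: le_trans h _; rewrite ler_wpM2l // ltW.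
- by move=> x; apply: le_trans (nuX r); apply: N1; rewrite r0 /=.
Qed.

End Model.

(** * The choice of the parameters *)

Lemma ln2_ge (R : realType) : 1 / 2 <= ln 2 :> R.
Proof.
have := @le_ln1Dx R (- (1 / 2)).
have -> : 1 + - (1 / 2) = 2^-1 :> R by field.
rewrite lnV ?posrE // => /(_ _); lra.
Qed.

(** The exponent [2 ^ k], a power of two for the sake of [op_bound_sym], is twice
    the least one above [log2 n]: doubling makes it exceed [1] even for [n = 2],
    and it keeps the order of [ln n]. *)
Lemma exists_exponent (R : realType) n : (1 < n)%N ->
  exists k, [/\ (0 < k)%N, (n <= 2 ^ (2 ^ k))%N &
    (2 ^ k)%:R <= 16 * ln n%:R :> R].
Proof.
move=> n1; set l := up_log 2 n; have /andP[nlo nhi] := @up_log_bounds 2 n isT n1.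
have l0 : (0 < l)%N by rewrite up_log_gt0.
have lk : (l <= 2 ^ up_log 2 l)%N by apply: up_logP.
have kl : (2 ^ up_log 2 l <= l.*2)%N.
  case: (ltnP 1 l) => [l1|l1]; last by rewrite (_ : l = 1%N) ?up_log1 //; lia.
  have := @up_log_gtn 2 l isT l1.
  have : (0 < up_log 2 l)%N by rewrite up_log_gt0.
  by case: (up_log 2 l) => // j _ /=; rewrite expnS; lia.
exists (up_log 2 l).+1; split=> //.
  apply: leq_trans nhi _; rewrite leq_exp2l // expnS -/l; lia.
have ln2 := ln2_ge R.
have lnn : (l.-1)%:R * (1 / 2) <= ln n%:R :> R.
  apply: (@le_trans _ _ (ln (2 ^+ l.-1))).
    by rewrite lnXn // -[leRHS]mulr_natl ler_wpM2l.
  by rewrite ler_ln ?posrE ?exprn_gt0 // ?ltr0n; [rewrite -natrX ler_nat ltnW|lia].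
have lnn2 : 1 / 2 <= ln n%:R :> R.
  apply: le_trans ln2 _; rewrite ler_ln ?posrE ?ltr0n ?ler_nat //; lia.
have : (2 ^ (up_log 2 l).+1)%:R <= (l.-1 * 4 + 4)%:R :> R.
  rewrite ler_nat expnS; lia.
rewrite natrD natrM; lra.
Qed.

Theorem theorem1p2 (R : realType) :
  exists C C0 K : R, [/\ 0 < C, 0 < C0 & 0 < K] /\
  forall (n s : nat) (p q : R),
    0 < q -> q < p -> p <= 3 / 4 -> q <= 3 / 4 ->
    C0 * ln n%:R / n%:R <= Num.max (p * (1 - p)) (q * (1 - q)) ->
    C * ln n%:R ^+ 7 * Num.sqrt (p * (1 - q)) * Num.sqrt n%:R / (p - q)
      <= s%:R ->
  exists (Delta : R) (r : nat), [/\ 0 < Delta, (1 < r)%N &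
    forall (k : nat) (P : {set {set 'I_n}}),
      partition P [set: 'I_n] -> #|P| = k -> s = \max_(X in P) #|X| ->
    forall S : {set 'I_n}, S \in P -> #|S| = s ->
      1 - K / n%:R
        <= ssbm_pr P p q (fun G => S \in power_iteration q Delta r G)].
Proof.
(* [1024 r ^ 3 <= 2 ^ 22 (ln n) ^ 3] as [r <= 16 ln n]; the factor 32 absorbs
   [sqrt (p (1 - q)) >= sqrt p / 2] and [16 (ln n) ^ 7 >= (ln n) ^ 3]. *)
exists (32 * 2 ^+ 22), 2, 1; split; first by split; rewrite ?mulr_gt0 ?exprn_gt0.
move=> n s p q q0 qp p34 q34 dense large.
have p0 : 0 < p := lt_trans q0 qp.
case: (ltnP 1 n) => [n1|n1]; last first.
  exists 1, 2%N; split => // k P partP _ _ S SP _.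
  have [x xS] : exists x, x \in S.
    by apply/set0Pn; apply: contraTneq SP => ->; case/and3P: partP.
  have n_eq1 : n = 1%N.
    by apply/eqP; rewrite eqn_leq n1; apply: leq_ltn_trans (ltn_ord x).
  have -> : 1 - 1 / n%:R = 0 :> R by rewrite n_eq1 divr1 subrr.
  apply: sumr_ge0 => G _.
  by apply: ssbm_ge0; lra.
case: (posnP s) => [s0|s0].
  exists 1, 2%N; split => // k P /and3P[_ _ P0] _ _ S SP Ss.
  by move: P0; rewrite -(cards0_eq (etrans Ss s0)) SP.
have [k [k0 nk kln]] := exists_exponent R n1.
have n0 : 0 < n%:R :> R by rewrite ltr0n; lia.
have L12 : 1 / 2 <= ln n%:R :> R.
  by apply: le_trans (ln2_ge R) _; rewrite ler_ln ?posrE // ler_nat.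
have np1 : 1 <= n%:R * p.
  have : 2 * ln n%:R / n%:R <= p.
    by apply: le_trans dense _; rewrite ge_max; apply/andP; split; nra.
  by rewrite ler_pdivrMr // [p * _]mulrC; apply: le_trans; lra.
exists (((p - q) * s%:R) ^+ (2 ^ k) / Num.sqrt s%:R / 2), (2 ^ k)%N; split.
- by rewrite !divr_gt0 ?exprn_gt0 ?sqrtr_gt0 ?mulr_gt0 ?ltr0n ?subr_gt0.
- by rewrite -[1%N](expn0 2) ltn_exp2l.
move=> m P partP _ smax S SP Ss.
apply: power_iteration_whp => //.
- lra.
- move: large; rewrite ler_pdivrMr ?subr_gt0 // [s%:R * _]mulrC; apply: le_trans.
  set L := ln n%:R in L12 kln *.
  have sp : Num.sqrt p / 2 <= Num.sqrt (p * (1 - q)).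
    have -> : Num.sqrt p / 2 = Num.sqrt (p * (1 / 2) ^+ 2).
      by rewrite sqrtrM ?ltW // sqrtr_sqr ger0_norm; lra.
    by rewrite ler_wsqrtr //; nra.
  have r3 : (2 ^ k)%:R ^+ 3 <= (16 * L) ^+ 3.
    by rewrite lerXn2r ?nnegrE //; lra.
  have L7 : L ^+ 3 <= 16 * L ^+ 7.
    have -> : 16 * L ^+ 7 = (2 * L) ^+ 4 * L ^+ 3 by ring.
    by rewrite ler_peMl ?exprn_ege1 ?exprn_ge0; lra.
  rewrite sqrtrM ?ler0n // [Num.sqrt n%:R * _]mulrC [leLHS]mulrA ler_wpM2r ?sqrtr_ge0 //.
  apply: (@le_trans _ _ (32 * 2 ^+ 22 * L ^+ 7 * (Num.sqrt p / 2))); last first.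
    by rewrite ler_wpM2l // !mulr_ge0 ?exprn_ge0 //; lra.
  rewrite [leRHS]mulrA [leRHS]mulrAC ler_wpM2r ?sqrtr_ge0 //.
  apply: (@le_trans _ _ (1024 * (16 * L) ^+ 3)); first by rewrite ler_wpM2l.
  have -> : 1024 * (16 * L) ^+ 3 = 2 ^+ 22 * L ^+ 3 by ring.
  have -> : 32 * 2 ^+ 22 * L ^+ 7 / 2 = 2 ^+ 22 * (16 * L ^+ 7) by field.
  by rewrite ler_wpM2l // exprn_ge0.
- by move=> X XP; rewrite smax (leq_bigmax_cond (F := fun X : {set 'I_n} => #|X|)).
Qed.
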